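(* Let $0<p\le q$. The box-counting dimension $\dim_{\mathrm{B}} S_{p,q}$ exists and: if $0<p<1$, then $$\dim_{\mathrm{B}} S_{p,q} = \frac{2+q-p}{1+q} = 1+\frac{1-p}{1+q};$$ otherwise, if $p\ge 1$, then $\dim_{\mathrm{B}} S_{p,q} = 1$.
   Context: For $0<p\le q$, the elliptical polynomial spiral is $S_{p,q} = \{ t^{-p}\cos t + i\, t^{-q}\sin t : 1 < t < \infty\} \subset \mathbb{C} \cong \mathbb{R}^2$. $\dim_{\mathrm{B}}$ denotes the box-counting (Minkowski) dimension, i.e. the common value of the lower and upper box-counting dimensions. *)

(* Defs.v *)
From HB Require Import structures.
From mathcomp Require Import all_boot all_order all_algebra.
From mathcomp Require Import all_classical all_reals all_analysis.
Set Implicit Arguments.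
Unset Strict Implicit.
Unset Printing Implicit Defensive.
Import Order.TTheory GRing.Theory Num.Theory.
Import numFieldNormedType.Exports.
Local Open Scope classical_set_scope.
Local Open Scope ring_scope.

(* The plane C = R^2 is R * R. Its library norm is the sup norm, so the
   Euclidean distance |x - y| is written out. *)
Definition dist2 (R : realType) (x y : R * R) : R :=
  Num.sqrt ((x.1 - y.1) ^+ 2 + (x.2 - y.2) ^+ 2).

(* diam2 set0 = -oo, so the empty set is an admissible covering piece. *)
Definition diam2 (R : realType) (U : set (R * R)) : \bar R :=
  ereal_sup [set (dist2 z.1 z.2)%:E | z in U `*` U].

Definition coverable (R : realType) (A : set (R * R)) (r : R) (n : nat) : Prop :=
  exists U : 'I_n -> set (R * R),
    (forall i, (diam2 (U i) <= r%:E)%E) /\ A `<=` \bigcup_i U i.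

(* Smallest number of sets of diameter at most r that cover A; it is +oo when
   no finite cover exists. *)
Definition covering_number (R : realType) (A : set (R * R)) (r : R) : \bar R :=
  ereal_inf [set n%:R%:E | n in coverable A r].

Definition box_ratio (R : realType) (A : set (R * R)) (r : R) : \bar R :=
  (lne (covering_number A r) / (- ln r)%:E)%E.

Definition lower_box_dim (R : realType) (A : set (R * R)) : \bar R :=
  limf_einf (box_ratio A) (0 : R)^'+.

Definition upper_box_dim (R : realType) (A : set (R * R)) : \bar R :=
  limf_esup (box_ratio A) (0 : R)^'+.

Definition is_box_dim (R : realType) (A : set (R * R)) (d : R) : Prop :=
  lower_box_dim A = d%:E /\ upper_box_dim A = d%:E.

Definition elliptical_spiral (R : realType) (p q : R) : set (R * R) :=
  [set (t `^ (- p) * cos t, t `^ (- q) * sin t) | t in [set t : R | 1 < t]].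

(* Main.v *)
(* Fix a scale r and put T = r^(-1/(1+q)), the time at which consecutive turns
   of the spiral are about r apart, since their vertical gap is of order
   t^(-q-1).
   Upper bound: on [k, k+1] the spiral is C k^(-p)-Lipschitz, so the part
   t <= T needs about (1/r) * sum_(k <= T) k^(-p) pieces, and the part t >= T
   lies in a box with half-sides T^(-p) and T^(-q), covered by a grid.  For
   p < 1 both are of order T^(1-p) / r.  The same bound holds with p replaced
   by any smaller exponent p', which for p >= 1 is taken close to 1.
   Lower bound: the vertical lines x = 2 r j, 0 <= x <= M^(-p) / 2, meet each
   turn 2 pi k <= t <= 2 pi k + pi / 2 with K <= k < 2 K and M = 4 pi K, and
   the crossing points are r-separated as soon as M^(-q-1) >> r.  This gives
   about K M^(-p) / r separated points, with K ~ T if p < 1 and K = 1 if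
   p >= 1. *)
Require Import Defs.
From mathcomp Require Import all_boot all_order all_algebra.
From mathcomp Require Import all_classical all_reals all_analysis.
From mathcomp Require Import ring lra.
Import Order.TTheory GRing.Theory Num.Theory.
Import numFieldNormedType.Exports.
Local Open Scope ring_scope.
Local Open Scope classical_set_scope.

(** * Distances, finite covers and separated points in the plane *)

Lemma dist2_le_normD (R : realType) (x y : R * R) :
  dist2 x y <= `|x.1 - y.1| + `|x.2 - y.2|.
Proof.
rewrite /dist2; move: (x.1 - y.1) (x.2 - y.2) => a b.
rewrite -[leRHS]ger0_norm ?addr_ge0// -sqrtr_sqr ler_wsqrtr//.
rewrite sqrrD !real_normK ?num_real// -addrA lerD2l lerDr.
by rewrite mulrn_wge0// mulr_ge0.
Qed.

Lemma dist2C (R : realType) (x y : R * R) : dist2 x y = dist2 y x.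
Proof. by rewrite /dist2 -sqrrN opprB -[X in _ + X]sqrrN opprB. Qed.

Lemma norm1_le_dist2 (R : realType) (x y : R * R) : `|x.1 - y.1| <= dist2 x y.
Proof. by rewrite -sqrtr_sqr ler_wsqrtr// lerDl sqr_ge0. Qed.

Lemma norm2_le_dist2 (R : realType) (x y : R * R) : `|x.2 - y.2| <= dist2 x y.
Proof. by rewrite -sqrtr_sqr ler_wsqrtr// lerDr sqr_ge0. Qed.

Lemma diam2_leP (R : realType) (U : set (R * R)) (r : R) :
  (diam2 U <= r%:E)%E <-> forall x y, U x -> U y -> dist2 x y <= r.
Proof.
split=> [/ereal_supP H x y Ux Uy|H].
  by rewrite -lee_fin; apply: H; exists (x, y).
by apply/ereal_supP => _ [[x y] [Ux Uy] <-]; rewrite lee_fin; exact: H.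
Qed.

(** Covers are built below over sums and products of ordinals. Enumerating a finite index type once
    avoids index arithmetic each time. *)
Lemma coverable_finType (R : realType) (T : finType) (A : set (R * R)) (r : R)
    (U : T -> set (R * R)) :
  (forall i x y, U i x -> U i y -> dist2 x y <= r) ->
  A `<=` \bigcup_i U i -> coverable A r #|T|.
Proof.
move=> Ur AU; exists (fun i => U (enum_val i)); split=> [i|x /AU[i _ Uix]].
  by apply/diam2_leP => x y; exact: Ur.
by exists (enum_rank i) => //=; rewrite enum_rankK.
Qed.

Lemma coverable_subset (R : realType) (A B : set (R * R)) (r : R) (n : nat) :
  A `<=` B -> coverable B r n -> coverable A r n.
Proof. by move=> AB [U [Ur BU]]; exists U; split=> // x /AB /BU. Qed.

Lemma coverableU (R : realType) (A B : set (R * R)) (r : R) (m n : nat) :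
  coverable A r m -> coverable B r n -> coverable (A `|` B) r (m + n)%N.
Proof.
move=> [U [Ur AU]] [V [Vr BV]].
have -> : (m + n = #|{: 'I_m + 'I_n}|)%N by rewrite card_sum !card_ord.
apply: (@coverable_finType _ _ _ _
  (fun i => match i with inl j => U j | inr j => V j end)).
  by case=> i; apply/diam2_leP.
by move=> x [/AU[i _ Ui]|/BV[i _ Vi]]; [exists (inl i)|exists (inr i)].
Qed.

Lemma coverable_bigcup (R : realType) (A : nat -> set (R * R)) (r : R)
    (n : nat -> nat) (N : nat) :
  (forall k, (k < N)%N -> coverable (A k) r (n k)) ->
  coverable (\bigcup_(k < N) A k) r (\sum_(k < N) n k)%N.
Proof.
elim: N => [_|N IH An].
  by rewrite bigcup_mkord !big_ord0; exists (fun=> set0); split=> // -[].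
rewrite bigcup_mkord !big_ord_recr/=; apply: coverableU; last exact: An.
by rewrite -bigcup_mkord; apply: IH => k /ltnW; exact: An.
Qed.

(** A piece of diameter at most [r] contains at most one of the separated points, so sending each
    point to a piece that contains it is injective. *)
Lemma leq_card_coverable (R : realType) (T : finType) (A : set (R * R)) (r : R)
    (n : nat) (f : T -> R * R) :
  (forall i, A (f i)) -> (forall i j, i != j -> r < dist2 (f i) (f j)) ->
  coverable A r n -> (#|T| <= n)%N.
Proof.
move=> Af fr [U [Ur AU]].
have /choice[g Ug] : forall i, exists k, U k (f i).
  by move=> i; have [k _ ?] := AU _ (Af i); exists k.
rewrite -[n]card_ord; apply: (@leq_card _ _ g) => i j gij.
apply/eqP; apply: contraT => /fr; rewrite ltNge => /negP[].
by move/diam2_leP : (Ur (g i)); apply; rewrite ?[in X in U X (f j)]gij.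
Qed.

(** * From power bounds on covering counts to box dimensions *)

Lemma covering_number_le (R : realType) (A : set (R * R)) (r : R) (n : nat) :
  coverable A r n -> (covering_number A r <= n%:R%:E)%E.
Proof. by move=> An; apply: ereal_inf_lbound; exists n. Qed.

Lemma lee_limf_esup (R : realType) (f : R -> \bar R) (F : set_system R)
    (b : \bar R) :
  (\forall r \near F, (f r <= b)%E) -> (limf_esup f F <= b)%E.
Proof.
move=> fb; apply: ge_ereal_inf.
exists (ereal_sup (f @` [set r | (f r <= b)%E])); first by eexists; [exact: fb|].
by apply/ereal_supP => _ [r /= ? <-].
Qed.

Lemma lee_limf_einf (R : realType) (f : R -> \bar R) (F : set_system R)
    (FF : Filter F) (b : \bar R) :
  (\forall r \near F, (b <= f r)%E) -> (b <= limf_einf f F)%E.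
Proof.
move=> fb; rewrite leeNr; apply: lee_limf_esup.
by apply: filterS fb => r /=; rewrite leeN2.
Qed.

(** Two members [V] and [W] of a proper filter share a point [r], and [f r] lies between the infimum
    of [f] over one and its supremum over the other. *)
Lemma limf_einf_le_esup (R : realType) (f : R -> \bar R) (F : set_system R)
    (FF : ProperFilter F) :
  (limf_einf f F <= limf_esup f F)%E.
Proof.
apply/ereal_infP => _ [V FV <-].
rewrite leeNl; apply/ereal_infP => _ [W FW <-].
have [r [Vr Wr]] := filter_ex (filterI FV FW).
apply: (@le_trans _ _ (- f r)%E).
  by rewrite leeN2; apply: ereal_sup_ubound; exists r.
by apply: ereal_sup_ubound; exists r.
Qed.

Lemma near_at_right0_ln (R : realType) (M : R) :
  \forall r \near (0 : R)^'+, [/\ 0 < r, r < 1, 0 < - ln r & M < - ln r].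
Proof.
near=> r.
have r0 : 0 < r by near: r; exact: nbhs_right_gt.
have r1 : r < 1 by near: r; exact: nbhs_right_lt.
split=> //; first by rewrite oppr_gt0 ln_lt0// r0.
rewrite ltrNr -[- M]expRK ltr_ln ?posrE ?expR_gt0//.
by near: r; apply: nbhs_right_lt; exact: expR_gt0.
Unshelve. all: by end_near.
Qed.

(** Taking logarithms bounds the ratio by [d + ln C / (- ln r)]. The second term drops below any
    [e > 0] once [- ln r > ln C / e], so the constant does not affect the dimension. *)
Lemma upper_box_dim_le (R : realType) (A : set (R * R)) (d C : R) :
  0 < C ->
  (\forall r \near (0 : R)^'+,
     exists2 n, coverable A r n & n%:R <= C * r `^ (- d)) ->
  (upper_box_dim A <= d%:E)%E.
Proof.
move=> C0 AC; apply/lee_addgt0Pr => e e0; apply: lee_limf_esup.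
have := @near_at_right0_ln R (ln C / e); apply: filterS2 AC.
move=> r [n An nC] [r0 r1 lnr0 rC].
have Cr0 : 0 < C * r `^ (- d) by rewrite mulr_gt0// powR_gt0.
have Nr0 : (0 <= covering_number A r)%E.
  by apply/ereal_infP => _ [m _ <-]; rewrite lee_fin.
have : (lne (covering_number A r) <= lne (C * r `^ (- d))%:E)%E.
  rewrite lee_lne ?in_itv/= ?leey ?andbT ?lee_fin ?(ltW Cr0)//.
  by apply: le_trans (covering_number_le _ _ _ _ An) _; rewrite lee_fin.
rewrite lne_EFin// lnM ?posrE ?powR_gt0// ln_powR /box_ratio inver gt_eqF// => H.
apply: le_trans (lee_wpmul2r _ H) _; first by rewrite lee_fin invr_ge0 ltW.
rewrite -EFinM lee_fin ler_pdivrMr// mulrDl addrC mulrN mulNr lerD2l.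
by rewrite mulrC -ler_pdivrMr// ltW.
Qed.

(** The same absorption of the constant, from below. A bound on every finite cover passes to the
    infimum, which is [+oo] if there is none. *)
Lemma lower_box_dim_ge (R : realType) (A : set (R * R)) (d c : R) :
  0 < c ->
  (\forall r \near (0 : R)^'+,
     forall n, coverable A r n -> c * r `^ (- d) <= n%:R) ->
  (d%:E <= lower_box_dim A)%E.
Proof.
move=> c0 Ac; apply/lee_subgt0Pr => e e0; apply: lee_limf_einf.
have := @near_at_right0_ln R (- ln c / e); apply: filterS2 Ac.
move=> r Ac [r0 r1 lnr0 rc].
have cr0 : 0 < c * r `^ (- d) by rewrite mulr_gt0// powR_gt0.
have Nr : ((c * r `^ (- d))%:E <= covering_number A r)%E.
  by apply/ereal_infP => _ [m Am <-]; rewrite lee_fin Ac.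
have : (lne (c * r `^ (- d))%:E <= lne (covering_number A r))%E.
  rewrite lee_lne ?in_itv/= ?leey ?andbT ?lee_fin ?(ltW cr0)//.
  by apply: le_trans Nr; rewrite lee_fin ltW.
rewrite lne_EFin// lnM ?posrE ?powR_gt0// ln_powR /box_ratio inver gt_eqF// => H.
apply: le_trans (lee_wpmul2r _ H); last by rewrite lee_fin invr_ge0 ltW.
rewrite -EFinM lee_fin ler_pdivlMr// mulrBl (addrC (ln c)) mulrN mulNr lerD2l.
by rewrite lerNl mulrC -ler_pdivrMr// ltW.
Qed.

Lemma is_box_dimP (R : realType) (A : set (R * R)) (d : R) :
  (d%:E <= lower_box_dim A)%E -> (upper_box_dim A <= d%:E)%E -> is_box_dim A d.
Proof.
move=> dl ud.
have lu : (lower_box_dim A <= upper_box_dim A)%E by exact: limf_einf_le_esup.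
split; apply/eqP; rewrite eq_le.
  by rewrite dl (le_trans lu ud).
by rewrite ud (le_trans dl lu).
Qed.

(** * Estimates for negative powers *)

(** Write the power as [expR (- p * ln u)] and use [1 + x <= expR x], then [ln u <= u - 1]. *)
Lemma powRN_bernoulli (R : realType) (p u : R) : 0 <= p -> 0 < u ->
  1 - p * (u - 1) <= u `^ (- p).
Proof.
move=> p0 u0; rewrite /powR gt_eqF//; apply: le_trans (expR_ge1Dx _).
rewrite lerD2l mulNr lerN2 ler_wpM2l//.
by rewrite -[X in ln X](subrK 1) addrC le_ln1Dx// ltrBrDr addNr.
Qed.

(** Bernoulli at [u = s / t], scaled by [t ^ (- p)]. No order between [s] and [t] is assumed: for
    [t <= s] this is a Lipschitz bound, and for [s <= t] both sides are nonpositive and it bounds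
    the gap between two turns from below. *)
Lemma powRN_subr_le (R : realType) (p s t : R) : 0 <= p -> 0 < t -> 0 < s ->
  t `^ (- p) - s `^ (- p) <= p * t `^ (- p) * ((s - t) / t).
Proof.
move=> p0 t0 s0; have u0 : 0 < s / t by rewrite divr_gt0.
have /(ler_wpM2l (powR_ge0 t (- p))) := @powRN_bernoulli _ p _ p0 u0.
rewrite -(powRM _ (ltW t0) (ltW u0)) (_ : t * (s / t) = s); last by field; rewrite gt_eqF.
rewrite (_ : (s - t) / t = s / t - 1); last by field; rewrite gt_eqF.
by rewrite mulrBr mulr1 mulrCA mulrA lerBlDr -lerBlDl.
Qed.

(** By induction, each term is at most [2 / (1 - p)] times the increment of [N ^ (1 - p)].
    Comparison with an integral would give [1 / (1 - p)]; the factor 2 pays for what Bernoulli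
    loses. *)
Lemma sum_powRN_le (R : realType) (p : R) (N : nat) : 0 < p < 1 ->
  \sum_(k < N) k.+1%:R `^ (- p) <= 2 / (1 - p) * N%:R `^ (1 - p).
Proof.
move=> /andP[p0 p1]; have a0 : 0 < 1 - p by rewrite subr_gt0.
elim: N => [|N IH]; first by rewrite big_ord0 mulr_ge0 ?powR_ge0// divr_ge0 ?ltW.
rewrite big_ord_recr/=; apply: le_trans (lerD IH (lexx _)) _.
(* The first term is treated apart: there [t / s] would be 0, where Bernoulli does not apply. *)
case: N {IH} => [|N].
  rewrite powR0 ?gt_eqF// !powR1 mulr0 add0r mulr1 ler_pdivlMr// mul1r.
  by lra.
(* Bernoulli for t / s gives s^a - t^a >= s^a * a / (s + a), and a <= s. *)
set s : R := N.+2%:R; set t : R := N.+1%:R; set a := 1 - p in a0 *.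
have s0 : 0 < s by rewrite ltr0n.
have t0 : 0 < t by rewrite ltr0n.
have st : t = s - 1 by rewrite /s -[N.+2%:R]natr1 addrK.
have u0 : 0 < t / s by rewrite divr_gt0.
have sa0 : 0 < s + a by exact: addr_gt0.
have := @powRN_bernoulli _ a _ (ltW a0) u0; rewrite powRN.
have -> : 1 - a * (t / s - 1) = (s + a) / s.
  by rewrite st; field; rewrite gt_eqF.
have -> : t `^ a = s `^ a * (t / s) `^ a.
  by rewrite -(powRM _ (ltW s0) (ltW u0)); congr (_ `^ _); field; rewrite gt_eqF.
have -> : s `^ (- p) = s `^ a / s.
  rewrite -[X in _ / X]powRr1 ?ltW// -powRN -powRD; first by congr powR; rewrite /a; lra.
  by rewrite (gt_eqF s0) implybT.
have w0 : 0 < (t / s) `^ a by rewrite powR_gt0.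
have x0 : 0 < s `^ a by rewrite powR_gt0.
move: ((t / s) `^ a) (s `^ a) w0 x0 => w x w0 x0 H.
have {}H : w <= s / (s + a).
  by rewrite -lef_pV2 ?posrE ?(divr_gt0 s0 sa0)// invf_div.
have s1 : 1 <= s by rewrite ler1n.
apply: (@le_trans _ _ (2 / a * (x * (s / (s + a))) + x / s)).
  by rewrite lerD2r ler_wpM2l ?divr_ge0 ?(ltW a0)// ler_wpM2l// ltW.
rewrite -subr_ge0.
have -> : 2 / a * x - (2 / a * (x * (s / (s + a))) + x / s) =
    x * (s - a) / (s * (s + a)).
  by clearbody s t a; field; rewrite !gt_eqF.
apply: divr_ge0; last exact: mulr_ge0 (ltW s0) (ltW sa0).
apply: mulr_ge0 (ltW x0) _; rewrite subr_ge0; apply: le_trans s1.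
by rewrite /a; lra.
Qed.

(** * Lipschitz bounds for the coordinates of the spiral *)

Lemma cos_lipschitz (R : realType) (s t : R) : s <= t ->
  `|cos s - cos t| <= t - s.
Proof.
move=> st; have [|c _] := @MVT_segment R cos (fun x => - sin x) s t st
  (fun x _ => is_derive_cos x).
  by apply: continuous_in_subspaceT => x _; exact: continuous_cos.
rewrite distrC => ->; rewrite normrM normrN (ger0_norm (x := t - s)) ?subr_ge0//.
by rewrite ler_piMl ?subr_ge0// sin_max.
Qed.

Lemma sin_lipschitz (R : realType) (s t : R) : s <= t ->
  `|sin s - sin t| <= t - s.
Proof.
move=> st; have [|c _] := @MVT_segment R sin cos s t st (fun x _ => is_derive_sin x).
  by apply: continuous_in_subspaceT => x _; exact: continuous_sin.
rewrite distrC => ->; rewrite normrM (ger0_norm (x := t - s)) ?subr_ge0//.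
by rewrite ler_piMl ?subr_ge0// cos_max.
Qed.

Lemma powRN_le_powRN (R : realType) (p p' s t : R) :
  0 <= p' <= p -> 1 <= s <= t -> t `^ (- p) <= s `^ (- p').
Proof.
move=> /andP[p0 pp] /andP[s1 st]; have t1 := le_trans s1 st.
apply: (@le_trans _ _ (t `^ (- p'))); first by rewrite ler_powR// lerN2.
rewrite !powRN lef_pV2 ?posrE ?powR_gt0 ?(lt_le_trans ltr01)//.
by rewrite ge0_ler_powR// nnegrE ltW// (lt_le_trans ltr01).
Qed.

(* The constant is stated with the weaker exponent p' <= p because, for p >= 1,
   the covering count uses some p' < 1. *)
Lemma powRN_mul_lipschitz (R : realType) (f : R -> R) (p p' k s t : R) :
  (forall x, `|f x| <= 1) -> (forall x y, x <= y -> `|f x - f y| <= y - x) ->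
  0 <= p' <= p -> 1 <= k <= s -> s <= t ->
  `|s `^ (- p) * f s - t `^ (- p) * f t| <= (1 + p) * k `^ (- p') * (t - s).
Proof.
move=> f1 flip pp ks st; have /andP[p'0 p'p] := pp; have /andP[k1 k_s] := ks.
have s1 := le_trans k1 k_s; have s0 := lt_le_trans ltr01 s1.
have t0 := lt_le_trans s0 st.
have p0 := le_trans p'0 p'p.
have sk := @powRN_le_powRN _ _ _ _ _ pp ks.
have ts0 : 0 <= t - s by rewrite subr_ge0.
have -> : s `^ (- p) * f s - t `^ (- p) * f t =
  s `^ (- p) * (f s - f t) + (s `^ (- p) - t `^ (- p)) * f t by ring.
apply: le_trans (ler_normD _ _) _; rewrite !normrM mulrDl mulrDl mul1r.
apply: lerD.
  by rewrite ger0_norm ?powR_ge0// ler_pM// ?powR_ge0// flip.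
have : 0 <= s `^ (- p) - t `^ (- p).
  by rewrite subr_ge0 powRN_le_powRN// ?p0 ?lexx// s1 st.
move=> h0; rewrite ger0_norm//; apply: le_trans (ler_piMr h0 (f1 _)) _.
apply: le_trans (powRN_subr_le _ _ _ _ p0 s0 t0) _.
rewrite ler_pM ?mulr_ge0 ?powR_ge0 ?invr_ge0 ?(ltW s0)// ?ler_wpM2l//.
by rewrite ler_piMr// invf_le1.
Qed.

(** * Explicit covers of arcs, boxes and the spiral *)

Lemma truncn_eq_dist (R : realType) (x y : R) : 0 <= x -> 0 <= y ->
  Num.truncn x = Num.truncn y -> `|x - y| <= 1.
Proof.
move=> /truncn_itv/andP[x1 x2] /truncn_itv/andP[y1 y2] xy.
rewrite xy -natr1 in x1 x2; rewrite -natr1 in y2.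
by rewrite ler_norml; lra.
Qed.

(** Cut the unit parameter interval into cells of length [r / L]; the image of each has diameter at
    most [r]. The endpoint [a + 1] may fall in cell [truncn (L / r)], hence the successor. *)
Lemma coverable_segment (R : realType) (g : R -> R * R) (a L r : R) :
  0 < L -> 0 < r ->
  (forall s t, a <= s -> s <= t -> t <= a + 1 -> dist2 (g s) (g t) <= L * (t - s)) ->
  coverable (g @` [set t | a <= t <= a + 1]) r (Num.truncn (L / r)).+1.
Proof.
move=> L0 r0 gL; have Lr0 : 0 < L / r by rewrite divr_gt0.
have gL' s t : a <= s <= a + 1 -> a <= t <= a + 1 ->
    dist2 (g s) (g t) <= L * `|t - s|.
  move=> /andP[as_ sa] /andP[at_ ta]; have [st|ts] := leP s t.
    by rewrite ger0_norm ?subr_ge0// gL.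
  rewrite ltr0_norm ?subr_lt0// opprB.
  by rewrite dist2C gL// ltW.
rewrite -[X in coverable _ _ X]card_ord.
apply: (@coverable_finType _ _ _ _ (fun i : 'I_(Num.truncn (L / r)).+1 => g @`
  [set t | a <= t <= a + 1 /\ Num.truncn ((t - a) * (L / r)) = i])).
  move=> i _ _ [s [sa si] <-] [t [ta ti] <-]; apply: le_trans (gL' _ _ sa ta) _.
  have pos u : a <= u <= a + 1 -> 0 <= (u - a) * (L / r).
    by move=> /andP[au _]; rewrite mulr_ge0 ?subr_ge0// ltW.
  have := @truncn_eq_dist _ _ _ (pos _ ta) (pos _ sa) (etrans ti (esym si)).
  rewrite -mulrBl opprB addrA subrK normrM (gtr0_norm Lr0) mulrA ler_pdivrMr//.
  by rewrite mul1r mulrC.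
move=> _ [t /= ta <-]; have /andP[at_ ta1] := ta.
have tN : (Num.truncn ((t - a) * (L / r)) < (Num.truncn (L / r)).+1)%N.
  by rewrite ltnS le_truncn// ler_piMl ?(ltW Lr0)// lerBlDl.
by exists (Ordinal tN) => //; exists t.
Qed.

(** A grid of squares of side [r / 2], so that the two coordinate differences add up to at most [r].
    A side of length [2 * a] meets about [4 * a / r] of them. *)
Lemma coverable_box (R : realType) (a b r : R) :
  0 < a -> 0 < b -> 0 < r ->
  coverable [set z : R * R | `|z.1| <= a /\ `|z.2| <= b] r
    ((Num.truncn (4 * a / r)).+1 * (Num.truncn (4 * b / r)).+1)%N.
Proof.
move=> a0 b0 r0; set m := (Num.truncn (4 * a / r)).+1.
set n := (Num.truncn (4 * b / r)).+1.
have pos (c x : R) : `|x| <= c -> 0 <= (x + c) * (2 / r).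
  rewrite ler_norml => /andP[cx _].
  by rewrite mulr_ge0 ?divr_ge0 ?(ltW r0)//; lra.
have dst (c x y : R) : `|x| <= c -> `|y| <= c ->
    Num.truncn ((x + c) * (2 / r)) = Num.truncn ((y + c) * (2 / r)) ->
    `|x - y| <= r / 2.
  move=> xc yc /(@truncn_eq_dist _ _ _ (pos _ _ xc) (pos _ _ yc)).
  rewrite -mulrBl normrM [X in _ * X]gtr0_norm ?divr_gt0//.
  rewrite (_ : x + c - (y + c) = x - y); last by ring.
  by rewrite -ler_pdivlMr ?divr_gt0// invf_div mul1r.
have bnd (c x : R) : `|x| <= c ->
    (Num.truncn ((x + c) * (2 / r)) < (Num.truncn (4 * c / r)).+1)%N.
  rewrite ler_norml => /andP[_ xc]; rewrite ltnS le_truncn// mulrA.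
  by rewrite ler_wpM2r ?invr_ge0 ?(ltW r0)//; lra.
have -> : (m * n = #|{: 'I_m * 'I_n}|)%N by rewrite card_prod !card_ord.
apply: (@coverable_finType _ _ _ _ (fun ij : 'I_m * 'I_n => [set z : R * R |
  [/\ `|z.1| <= a, `|z.2| <= b, Num.truncn ((z.1 + a) * (2 / r)) = ij.1
    & Num.truncn ((z.2 + b) * (2 / r)) = ij.2]])).
  move=> [i j] x y /= [xa xb xi xj] [ya yb yi yj].
  apply: le_trans (dist2_le_normD _ _ _) _; rewrite (splitr r).
  by apply: lerD; [apply: (dst a)|apply: (dst b)] => //; rewrite ?xi ?yi ?xj ?yj.
move=> x /= [xa xb].
by exists (Ordinal (bnd _ _ xa), Ordinal (bnd _ _ xb)).
Qed.

(** The scale is written as a power of [T] so that every count becomes a power of [T]. In the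
    constant, the fraction comes from the sum of the Lipschitz constants over the arcs. The 26 is 1
    for rounding up on at most [T] arcs, plus 25 = 5 * 5 for the grid, where [4 * x + 1 <= 5 * x]
    for [x >= 1]. *)
Lemma spiral_coverable (R : realType) (p p' q T : R) :
  0 < p' < 1 -> p' <= p -> p <= q -> 1 <= T ->
  exists2 n, coverable (elliptical_spiral p q) (T `^ (- (1 + q))) n &
    n%:R <= (2 * (2 + p + q) / (1 - p') + 26) * T `^ (2 + q - p').
Proof.
move=> /andP[p'0 p'1] p'p pq T1.
set r := T `^ (- (1 + q)); set L := 2 + p + q.
have T0 : 0 < T by rewrite (lt_le_trans ltr01).
have r0 : 0 < r by rewrite powR_gt0.
have L0 : 0 < L by rewrite /L; lra.
set g : R -> R * R := fun t => (t `^ (- p) * cos t, t `^ (- q) * sin t).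
set N := Num.truncn T.
have /andP[NT TN] : N%:R <= T < N.+1%:R by rewrite truncn_itv// ltW.
pose A k := g @` [set t | k.+1%:R <= t <= k.+1%:R + 1].
pose Lk k := L * k.+1%:R `^ (- p').
pose nk k := (Num.truncn (Lk k / r)).+1.
have Lk0 k : 0 < Lk k by rewrite mulr_gt0// powR_gt0// ltr0n.
have Acov k : (k < N)%N -> coverable (A k) r (nk k).
  move=> _; apply: coverable_segment => // s t ks st tk.
  apply: le_trans (dist2_le_normD _ _ _) _ => /=.
  have k1 : 1 <= (k.+1%:R : R) <= s by rewrite ler1n.
  have H1 : `|s `^ (- p) * cos s - t `^ (- p) * cos t| <=
      (1 + p) * k.+1%:R `^ (- p') * (t - s).
    apply: powRN_mul_lipschitz => //; last by rewrite (ltW p'0).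
      exact: cos_max.
    exact: cos_lipschitz.
  have H2 : `|s `^ (- q) * sin s - t `^ (- q) * sin t| <=
      (1 + q) * k.+1%:R `^ (- p') * (t - s).
    apply: powRN_mul_lipschitz => //.
    - exact: sin_max.
    - exact: sin_lipschitz.
    - by rewrite (ltW p'0) (le_trans p'p).
  apply: le_trans (lerD H1 H2) _; rewrite -!mulrDl /Lk /L.
  by rewrite (_ : 1 + p + (1 + q) = 2 + p + q)//; ring.
have Bcov := @coverable_box R (T `^ (- p')) (T `^ (- q)) r
  (powR_gt0 _ T0) (powR_gt0 _ T0) r0.
have := coverableU _ _ _ _ _ _ (coverable_bigcup _ _ _ _ _ Acov) Bcov.
set n := (_ + _)%N => Sn; exists n.
  apply: coverable_subset Sn => _ [t /= t1 <-].
  (* The parameter is split at [N + 1 > T]: later points lie in the box, earlier ones on the arcs.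
     Arc [k] starts at [k + 1], so the arc through [t] has index [truncn t - 1], which is legitimate
     since [t > 1]. *)
  have [tN|tN] := leP N.+1%:R t; [right|left].
    have Tt : T <= t by rewrite (le_trans (ltW TN)).
    by split => /=; rewrite normrM ger0_norm ?powR_ge0//;
      apply: le_trans (ler_piMr (powR_ge0 _ _) _) _; rewrite ?cos_max ?sin_max//;
      apply: powRN_le_powRN; rewrite ?T1 ?Tt ?p'p ?lexx ?(ltW p'0)//; lra.
  have t0 : 0 <= t by rewrite ltW// (lt_trans ltr01).
  have /andP[tt1 tt2] := truncn_itv t0.
  have tr0 : (0 < Num.truncn t)%N by rewrite truncn_gt0 ltW.
  exists (Num.truncn t).-1 => /=.
    by rewrite -ltnS prednK// truncn_lt_nat.
  by exists t => //=; rewrite prednK// tt1 natr1 ltW.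
set a := 1 - p'; have a0 : 0 < a by rewrite /a; lra.
set D := 2 + q - p'.
have rV : r^-1 = T `^ (1 + q) by rewrite /r powRN invrK.
have TD c : T `^ (- c) / r = T `^ (1 + q - c).
  by rewrite rV -powRD ?(gt_eqF T0) ?implybT// addrC.
have trb (x : R) : 0 <= x -> (Num.truncn x).+1%:R <= x + 1 :> R.
  by move=> x0; rewrite -natr1 lerD2r truncn_le.
have T1D (c : R) : 0 <= c -> 1 <= T `^ c.
  by move=> c0; rewrite -[leLHS](@powRr0 R T) ler_powR.
rewrite natrD natrM natr_sum.
have B1 : (Num.truncn (4 * T `^ (- p') / r)).+1%:R <= 5 * T `^ (1 + q - p').
  rewrite -mulrA TD; apply: le_trans (trb _ _) _.
    by rewrite mulr_ge0// powR_ge0.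
  by have := T1D (1 + q - p') ltac:(lra); lra.
have B2 : (Num.truncn (4 * T `^ (- q) / r)).+1%:R <= 5 * T.
  rewrite -mulrA TD addrK powRr1 ?(ltW T0)//; apply: le_trans (trb _ _) _; lra.
have TT : T `^ D = T `^ (1 + q - p') * T.
  rewrite -[X in _ * X]powRr1 ?(ltW T0)// -powRD ?(gt_eqF T0) ?implybT//.
  by congr (_ `^ _); rewrite /D; ring.
have BB : (Num.truncn (4 * T `^ (- p') / r)).+1%:R *
   (Num.truncn (4 * T `^ (- q) / r)).+1%:R <= 25 * T `^ D.
  apply: le_trans (ler_pM _ _ B1 B2) _ => //; rewrite TT.
  by rewrite (_ : 5 * _ * _ = 25 * (T `^ (1 + q - p') * T)) //; ring.
have TTD : T <= T `^ D by rewrite le1r_powR// /D; lra.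
have S1 : \sum_(k < N) (nk k)%:R <= \sum_(k < N) (L / r * k.+1%:R `^ (- p') + 1).
  apply: ler_sum => k _; rewrite mulrAC; apply: trb.
  by rewrite divr_ge0 ?(ltW r0)// ltW.
have S2 : \sum_(k < N) (L / r * k.+1%:R `^ (- p') + 1) <=
    2 * L / a * T `^ D + T `^ D.
  rewrite big_split/= -mulr_sumr sumr_const card_ord; apply: lerD.
    apply: (@le_trans _ _ (L / r * (2 / a * N%:R `^ a))).
      rewrite ler_wpM2l ?divr_ge0 ?(ltW r0) ?(ltW L0)//.
      by apply: sum_powRN_le; rewrite p'0.
    have NTa : N%:R `^ a <= T `^ a.
      by rewrite ge0_ler_powR ?nnegrE ?ler0n ?(ltW a0) ?(ltW T0).
    have -> : T `^ D = T `^ (1 + q) * T `^ a.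
      rewrite -powRD ?(gt_eqF T0) ?implybT//.
      by congr (_ `^ _); rewrite /D /a; ring.
    rewrite rV.
    rewrite (_ : L * _ * _ = 2 * L / a * (T `^ (1 + q) * N%:R `^ a)); last by ring.
    by rewrite ler_wpM2l ?divr_ge0 ?mulr_ge0 ?(ltW a0) ?(ltW L0)// ler_wpM2l ?powR_ge0.
  by apply: le_trans NT TTD.
apply: le_trans (lerD (le_trans S1 S2) BB) _; rewrite -/a -/D -/L.
by rewrite [leRHS](_ : _ = 2 * L / a * T `^ D + T `^ D + 25 * T `^ D) //; ring.
Qed.

(** * Separated points on the spiral *)

(** On this quarter turn the first coordinate goes from [(2 pi k) ^ (- p)] down to 0, so it takes
    the value [x]. As [t <= M], the bound on [x] forces [cos t <= 1 / 2], which keeps [sin t] away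
    from 0; the vertical separation of the crossings rests on this. *)
Lemma spiral_crossing (R : realType) (p M x : R) (k : nat) :
  0 < p -> (0 < k)%N -> 2 * pi * k.+1%:R <= M -> 0 <= x <= M `^ (- p) / 2 ->
  exists t, [/\ 2 * pi * k%:R <= t, t <= 2 * pi * k%:R + pi / 2,
    t `^ (- p) * cos t = x & 2^-1 <= sin t].
Proof.
move=> p0 k0 kM /andP[x0 xM]; set a := 2 * pi * k%:R.
have pi2 : 2 <= pi :> R by exact: pi_ge2.
have k1 : 1 <= k%:R :> R by rewrite ler1n.
have kS : 2 * pi * k.+1%:R = a + 2 * pi by rewrite -[k.+1%:R]natr1 mulrDr mulr1.
have a1 : 1 <= a.
  by rewrite /a; nra.
have M0 : 0 < M by lra.
have acos u : cos (a + u) = cos u.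
  by rewrite addrC (_ : a = (pi *+ 2) *+ k) ?(periodicn (@cosD2pi R))//;
    rewrite /a -mulr_natr -mulr_natr; ring.
have asin u : sin (a + u) = sin u.
  by rewrite addrC (_ : a = (pi *+ 2) *+ k) ?(periodicn (@sinD2pi R))//;
    rewrite /a -mulr_natr -mulr_natr; ring.
have cosa : cos a = 1 by rewrite -[a]addr0 acos cos0.
have [|||t] := @IVT R (fun t => t `^ (- p) * cos t) a (a + pi / 2) x.
- by rewrite lerDl; lra.
- apply: derivable_within_continuous => t; rewrite in_itv/= => /andP[at_ _].
  apply: derivableM; last exact: derivable_cos.
  by apply: derivable_powR; rewrite in_itv/= andbT; lra.
- rewrite acos cos_pihalf mulr0 cosa mulr1.
  have aM : x <= a `^ (- p).
    apply: (le_trans xM); apply: (@le_trans _ _ (M `^ (- p))).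
      by rewrite ler_pdivrMr// ler_peMr ?powR_ge0//; lra.
    by apply: powRN_le_powRN; rewrite ?lexx ?(ltW p0) ?a1//=; lra.
  by rewrite ge_min le_max x0 orbT aM.
rewrite in_itv/= => /andP[at_ ta] tx; exists t; split=> //.
have t0 : 0 < t by lra.
have tE : t = a + (t - a) by ring.
have s0 : 0 <= sin t.
  by rewrite tE asin sin_ge0_pi//; apply/andP; split; lra.
have c0 : 0 <= cos t.
  by rewrite tE acos cos_ge0_pihalf//; apply/andP; split; lra.
have tp : 0 < t `^ (- p) by rewrite powR_gt0.
have c1 : cos t <= 2^-1.
  rewrite -(ler_pM2l tp) tx; apply: (le_trans xM); rewrite ler_pM2r ?invr_gt0//.
  by apply: powRN_le_powRN; rewrite ?lexx ?(ltW p0)//=; lra.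
have := cos2Dsin2 t; nra.
Qed.

(** The points are indexed by the turn [K + k] and the line [x = 2 r j]. Those on different lines
    are at least [2 r] apart horizontally; those on one line are separated vertically. All turns
    used end before [4 pi K]. *)
Lemma spiral_packing (R : realType) (p q r : R) (K n : nat) :
  0 < p -> p <= q -> (0 < K)%N -> 0 < r ->
  r < q / 4 * (4 * pi * K%:R) `^ (- (1 + q)) ->
  coverable (elliptical_spiral p q) r n ->
  K%:R * ((4 * pi * K%:R) `^ (- p) / (4 * r)) <= n%:R.
Proof.
move=> p0 pq K0 r0; set M := 4 * pi * K%:R => rM Sn.
have pi2 : 2 <= pi :> R by exact: pi_ge2.
have K1 : 1 <= K%:R :> R by rewrite ler1n.
have M0 : 0 < M by rewrite /M !mulr_gt0 ?ltr0n// pi_gt0.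
set X := M `^ (- p) / (4 * r).
have X0 : 0 <= X by rewrite divr_ge0 ?powR_ge0// mulr_ge0// ltW.
(* The line at abscissa [2 r j] is admissible exactly when [j <= X]; counting [j = 0] gives [J > X]
   lines. *)
set J := (Num.truncn X).+1.
have crossing (kj : 'I_K * 'I_J) : exists t : R,
    [/\ 2 * pi * (K + kj.1)%:R <= t, t <= 2 * pi * (K + kj.1)%:R + pi / 2,
        t `^ (- p) * cos t = 2 * r * kj.2%:R & 2^-1 <= sin t].
  apply: (@spiral_crossing _ _ M); rewrite ?addn_gt0 ?K0//.
    rewrite (_ : M = 2 * pi * (K + K)%:R); last by rewrite /M natrD; ring.
    by rewrite ler_wpM2l ?mulr_ge0 ?pi_ge0// ler_nat -addnS leq_add2l.
  rewrite mulr_ge0 ?mulr_ge0 ?(ltW r0)//=.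
  have jX : kj.2%:R <= X.
    by rewrite -truncn_ge_nat// -ltnS.
  rewrite mulrC -ler_pdivlMr ?mulr_gt0//; apply: (le_trans jX).
  by rewrite /X le_eqVlt; apply/orP; left; apply/eqP; field; rewrite gt_eqF.
have /choice[t tP] := crossing.
have JX : K%:R * X <= (K * J)%:R.
  by rewrite natrM ler_wpM2l// ltW// truncnS_gt.
apply: le_trans JX _; rewrite ler_nat.
have -> : (K * J = #|{: 'I_K * 'I_J}|)%N by rewrite card_prod !card_ord.
pose f kj := ((t kj) `^ (- p) * cos (t kj), (t kj) `^ (- q) * sin (t kj)).
apply: (@leq_card_coverable _ _ _ _ _ f) Sn => [kj|].
  exists (t kj) => //=; have [+ _ _ _] := tP kj.
  have : 1 <= (K + kj.1)%:R :> R by rewrite ler1n addn_gt0 K0.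
  by nra.
have xdist (kj kj' : 'I_K * 'I_J) :
    (kj.2 < kj'.2)%N -> r < dist2 (f kj) (f kj').
  move=> jj'; apply: lt_le_trans (norm1_le_dist2 _ _ _) => /=.
  have [_ _ -> _] := tP kj; have [_ _ -> _] := tP kj'.
  have jj1 : kj.2%:R + 1 <= kj'.2%:R :> R by rewrite natr1 ler_nat.
  rewrite distrC -mulrBr; apply: lt_le_trans (ler_norm _); nra.
have ydist (kj kj' : 'I_K * 'I_J) : kj.2 = kj'.2 -> (kj.1 < kj'.1)%N ->
    r < dist2 (f kj) (f kj').
  move=> jj' kk'; apply: lt_le_trans (norm2_le_dist2 _ _ _) => /=.
  have [t1 t2 tx ts] := tP kj; have [t1' t2' tx' ts'] := tP kj'.
  rewrite jj' -tx' in tx; move: (t kj) (t kj') t1 t2 tx ts t1' t2' tx' ts'.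
  move=> u v u1 u2 uv us v1 v2 vx vs.
  have kk1 : (K + kj.1)%:R + 1 <= (K + kj'.1)%:R :> R.
    by rewrite natr1 ler_nat -addnS leq_add2l.
  have k2K : (K + kj'.1)%:R + 1 <= 2 * K%:R :> R.
    by rewrite natr1 -natrM ler_nat mul2n -addnn -addnS leq_add2l.
  have k1 : 1 <= (K + kj.1)%:R :> R by rewrite ler1n addn_gt0 K0.
  have u0 : 1 <= u by nra.
  have uv1 : u + 1 <= v by nra.
  have vM : v <= M by rewrite /M; nra.
  have vp0 : 0 < v `^ (- p) by rewrite powR_gt0//; lra.
  have vup : v `^ (- p) <= u `^ (- p).
    by apply: powRN_le_powRN; rewrite ?lexx ?(ltW p0)//=; lra.
  have x0 : 0 <= 2 * r * kj'.2%:R by rewrite mulr_ge0 ?mulr_ge0 ?(ltW r0).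
  have cu0 : 0 <= cos u.
    by rewrite -(pmulr_rge0 _ (lt_le_trans vp0 vup)) uv vx.
  (* On a fixed vertical line cos t = x t^p grows with t, so sin t decreases. *)
  have cuv : cos u <= cos v.
    by rewrite -(ler_pM2l vp0) -uv ler_wpM2r.
  have suv : sin v <= sin u.
    have := cos2Dsin2 u; have := cos2Dsin2 v; nra.
  have v0 : 0 < v by lra.
  have q0 : 0 < q by exact: lt_le_trans pq.
  have := @powRN_subr_le _ q u v (ltW q0) v0 ltac:(lra).
  have Mq0 : 0 < M `^ (- (1 + q)) by rewrite powR_gt0.
  have Mv : M `^ (- (1 + q)) <= v `^ (- (1 + q)).
    by apply: powRN_le_powRN; rewrite ?lexx ?andbT//=; lra.
  have vE : v `^ (- (1 + q)) = v `^ (- q) / v.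
    rewrite opprD addrC powRD ?(gt_eqF v0) ?implybT//.
    by rewrite powR_inv1// ltW.
  rewrite (_ : q * _ * _ = q * (v `^ (- q) / v) * (u - v)); last first.
    by field; rewrite gt_eqF.
  rewrite -vE => H.
  have {}H : q * M `^ (- (1 + q)) <= u `^ (- q) - v `^ (- q).
    have : q * M `^ (- (1 + q)) <= q * v `^ (- (1 + q)) by rewrite ler_pM2l.
    have : 0 < q * v `^ (- (1 + q)) by rewrite mulr_gt0// powR_gt0.
    by nra.
  (* Since [sin v <= sin u] and both are at least 1/2, the vertical gap is at least half of
     [u ^ (- q) - v ^ (- q)], hence at least [q / 2 * M ^ (- (1 + q))], which exceeds [2 r]. *)
  apply: lt_le_trans (ler_norm _).
  have vq0 : 0 <= v `^ (- q) by exact: powR_ge0.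
  nra.
move=> [k j] [k' j'] /eqP kj; have [jj|jj|jj] := ltngtP j j'.
- exact: xdist.
- by rewrite dist2C; exact: xdist.
have {}jj : j = j' by exact/val_inj.
have [kk|kk|kk] := ltngtP k k'.
- exact: ydist.
- by rewrite dist2C; exact: ydist.
by case: kj; rewrite jj (val_inj kk).
Qed.

(** * Bounds on the dimension and the conclusion *)

Lemma upper_box_dim_spiral (R : realType) (p p' q : R) :
  0 < p' < 1 -> p' <= p -> p <= q ->
  (upper_box_dim (elliptical_spiral p q) <= ((2 + q - p') / (1 + q))%:E)%E.
Proof.
move=> /andP[p'0 p'1] p'p pq; have q1 : 0 < 1 + q by lra.
apply: (@upper_box_dim_le _ _ _ (2 * (2 + p + q) / (1 - p') + 26)).
  by rewrite ltr_pwDr// divr_ge0//; lra.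
have := @near_at_right0_ln R 0; apply: filterS => r [r0 r1 _ _].
set T := r `^ (- (1 + q)^-1).
have T1 : 1 <= T.
  rewrite /T powRN invf_ge1 ?powR_gt0// -[leRHS](@powRr0 R r).
  by rewrite ger_powR ?r0 ?(ltW r1)// invr_ge0 ltW.
have Tr : T `^ (- (1 + q)) = r.
  rewrite /T -powRrM mulrNN mulVf ?gt_eqF// powRr1//; exact: ltW.
have [|n Sn nT] := @spiral_coverable _ p p' q T _ p'p pq T1; first by rewrite p'0.
exists n; first by rewrite -Tr.
by move: nT; rewrite /T -powRrM mulNr (mulrC _^-1).
Qed.

Lemma lower_box_dim_spiral_lt1 (R : realType) (p q : R) :
  0 < p < 1 -> p <= q ->
  (((2 + q - p) / (1 + q))%:E <= lower_box_dim (elliptical_spiral p q))%E.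
Proof.
move=> /andP[p0 p1] pq; have q1 : 0 < 1 + q by lra.
have q0 : 0 < q by lra.
have pi0 : 0 < pi :> R by exact: pi_gt0.
(* This b makes q / 4 * (b T)^(-(1 + q)) equal to 2 r > r. *)
set b := (q / 8) `^ (1 + q)^-1.
have b0 : 0 < b by rewrite powR_gt0// divr_gt0.
have bq : b `^ (- (1 + q)) = 8 / q.
  by rewrite powRN /b -powRrM mulVf ?gt_eqF// powRr1 ?invf_div// divr_ge0// ltW.
apply: (@lower_box_dim_ge _ _ _ ((b / 2) `^ (1 - p) / (16 * pi))).
  by rewrite divr_gt0 ?mulr_gt0 ?powR_gt0// divr_gt0.
(* This threshold on [- ln r] says that [b * T >= 4 * pi], which makes [K] below at least 1. *)
have := @near_at_right0_ln R ((1 + q) * ln (4 * pi / b)).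
apply: filterS => r [r0 r1 _ rb] n Sn.
set T := r `^ (- (1 + q)^-1).
have T0 : 0 < T by rewrite powR_gt0.
have Tr : T `^ (- (1 + q)) = r.
  by rewrite /T -powRrM mulrNN mulVf ?gt_eqF// powRr1// ltW.
have bT : 4 * pi <= b * T.
  rewrite -ler_pdivrMl// mulrC -ler_ln ?posrE ?divr_gt0 ?mulr_gt0//.
  by rewrite ln_powR mulNr -mulrN ler_pdivlMl// ltW.
(* The largest number of turns with [M <= b * T], as separation requires. Since [K + 1 <= 2 * K],
   also [M >= b * T / 2], which keeps the count of order [T ^ (1 - p) / r]. *)
set K := Num.truncn (b * T / (4 * pi)).
have Kx1 : 1 <= b * T / (4 * pi) by rewrite ler_pdivlMr ?mulr_gt0// mul1r.
have K0 : (0 < K)%N by rewrite truncn_gt0.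
have K1 : 1 <= K%:R :> R by rewrite ler1n.
have /andP[Kl Ku] := truncn_itv (le_trans ler01 Kx1).
rewrite -/K -[K.+1%:R]natr1 in Ku; rewrite -/K in Kl; clearbody K.
set M : R := 4 * pi * K%:R.
have M0 : 0 < M by rewrite /M !mulr_gt0// ltr0n.
have MT : M <= b * T by rewrite /M mulrC -ler_pdivlMr// mulr_gt0.
have TM : b / 2 * T <= M.
  rewrite ltr_pdivrMr ?mulr_gt0// in Ku.
  have : (K%:R + 1) * (4 * pi) <= (2 * K%:R) * (4 * pi) :> R.
    by apply: ler_wpM2r; [rewrite mulr_ge0 ?(ltW pi0)|rewrite mulr2n mulrDl mul1r lerD2l].
  by rewrite /M; clear -Ku; lra.
have rM : r < q / 4 * M `^ (- (1 + q)).
  have rM8 : 8 / q * r <= M `^ (- (1 + q)).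
    rewrite -bq -{1}Tr -powRM ?(ltW b0) ?(ltW T0)// !powRN.
    rewrite lef_pV2 ?posrE ?(powR_gt0 _ M0) ?(powR_gt0 _ (mulr_gt0 b0 T0))//.
    by rewrite ge0_ler_powR ?nnegrE ?(ltW q1) ?(ltW M0)// (le_trans (ltW M0)).
  have q4 : 0 <= q / 4 by rewrite divr_ge0// ltW.
  apply: lt_le_trans (ler_wpM2l q4 rM8).
  rewrite (_ : q / 4 * _ = 2 * r); last by field; rewrite gt_eqF.
  by rewrite mulr2n mulrDl mul1r ltrDl.
apply: le_trans (@spiral_packing _ p q r K n p0 pq K0 r0 rM Sn).
(* Substituting [K = M / (4 pi)] leaves a power of [M] with exponent [1 - p > 0], so the lower bound
   on [M] is the one that matters. *)
rewrite -/M (_ : K%:R * _ = M `^ (1 - p) / (16 * pi) * r^-1); last first.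
  rewrite powRD ?(gt_eqF M0) ?implybT// powRr1 ?(ltW M0)//.
  by rewrite /M; move: (@pi R) pi0 => c c0; field; rewrite !gt_eqF.
have -> : r `^ (- ((2 + q - p) / (1 + q))) = T `^ (1 - p) * r^-1.
  rewrite /T -powRrM -[r^-1]powR_inv1 ?(ltW r0)// -powRD ?(gt_eqF r0) ?implybT//.
  by congr (_ `^ _); field; rewrite gt_eqF.
rewrite mulrA ler_wpM2r ?invr_ge0 ?(ltW r0)// mulrAC.
rewrite ler_wpM2r ?invr_ge0 ?mulr_ge0 ?(ltW pi0)//.
rewrite -powRM ?(ltW T0)//; last by rewrite divr_ge0// ltW.
have bT2 : 0 <= b / 2 * T by rewrite mulr_ge0 ?divr_ge0 ?(ltW b0) ?(ltW T0).
by rewrite ge0_ler_powR ?subr_ge0 ?nnegrE ?bT2 ?(ltW p1) ?(ltW M0).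
Qed.

(** With a single turn ([K = 1]) the value of [M] is fixed, so the separation condition holds for
    all small [r] and the number of lines grows like [1 / r]. *)
Lemma lower_box_dim_spiral_ge1 (R : realType) (p q : R) :
  0 < p -> p <= q -> (1%:E <= lower_box_dim (elliptical_spiral p q))%E.
Proof.
move=> p0 pq; set M : R := 4 * pi * 1%:R.
have M0 : 0 < M by rewrite /M !mulr_gt0// pi_gt0.
have q0 : 0 < q by lra.
apply: (@lower_box_dim_ge _ _ _ (M `^ (- p) / 4)).
  by rewrite divr_gt0// powR_gt0.
near=> r => n Sn.
have r0 : 0 < r by near: r; exact: nbhs_right_gt.
have rM : r < q / 4 * M `^ (- (1 + q)).
  near: r; apply: nbhs_right_lt; rewrite mulr_gt0 ?divr_gt0 ?powR_gt0//.
apply: le_trans (@spiral_packing _ p q r 1 n p0 pq isT r0 rM Sn).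
by rewrite mul1r powR_inv1 ?(ltW r0)// invfM mulrA.
Unshelve. all: by end_near.
Qed.

Theorem corollary2p3 (R : realType) (p q : R) (hp : 0 < p) (hpq : p <= q) :
  exists d : R,
    is_box_dim (elliptical_spiral p q) d /\
    (p < 1 -> d = (2 + q - p) / (1 + q) /\ d = 1 + (1 - p) / (1 + q)) /\
    (1 <= p -> d = 1).
Proof.
have q1 : 0 < 1 + q by lra.
have [p1|p1] := ltP p 1.
  exists ((2 + q - p) / (1 + q)); split; last split => //.
    apply: is_box_dimP; first by apply: lower_box_dim_spiral_lt1; rewrite // hp.
    by apply: upper_box_dim_spiral; rewrite ?hp.
  by move=> _; split=> //; field; rewrite gt_eqF.
exists 1; split; last by split.
apply: is_box_dimP; first exact: lower_box_dim_spiral_ge1.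
(* The exponent is [1 + (1 - p') / (1 + q)], so [1 - p' <= e] keeps it below [1 + e]. The
   alternative 1/2 keeps [p'] positive when [e] is large. *)
apply/lee_addgt0Pr => e e0; set p' := Num.max (1 - e) 2^-1.
have p'e : 1 - e <= p' by rewrite le_max lexx.
have p'2 : 2^-1 <= p' by rewrite le_max lexx orbT.
have p'1 : p' < 1 by rewrite gt_max; apply/andP; split; lra.
have p'0 : 0 < p' by lra.
apply: (le_trans (@upper_box_dim_spiral _ p p' q _ _ hpq)); [by rewrite p'0|lra|].
by rewrite -EFinD lee_fin ler_pdivrMr//; nra.
Qed.
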